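(* Let $n$ be a positive integer and let $h, j > 0$ be parameters with $h \le n^{1/4}/\sqrt{\log n}$ and $j \le \sqrt{h}$. Consider a frontyard/backyard hash table that can hold up to $n$ items, whose front yard consists of $m = n/h$ bins, each of capacity $h + j\sqrt{h+1} + 1$. Each item $x$ is assigned a bin $H(x)$ chosen uniformly at random (independently across items). When an item $x$ is inserted, if bin $H(x)$ has room the item is placed into bin $H(x)$, and if bin $H(x)$ is full the item is placed into the backyard; items are never moved once placed, and a deleted item is simply removed from wherever it is stored. Consider any sequence of $\mathrm{poly}(m)$ insertions and deletions (fixed independently of the random hash values) such that the table never contains more than $n$ items. Then, with probability $1 - 1/\mathrm{poly}(n)$, at every moment during this sequence the number of items in the backyard is $O\!\left(n / 2^{\Omega(j^2)} + n^{3/4}\sqrt{\log n}\right)$.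
   Context: The ''front yard'' is an array of $m$ bins (buckets) of fixed capacity; the ''backyard'' is an auxiliary structure of unbounded capacity that receives exactly those inserted items whose front-yard bin was full at the time of their insertion. Here $\mathrm{poly}(\cdot)$ denotes a polynomial, and ''with probability $1-1/\mathrm{poly}(n)$'' means for any desired constant exponent, with suitable constants in the $O$ and $\Omega$. *)

(* Defs.v *)
From mathcomp Require Import all_boot.
From Stdlib Require Import Reals.

Set Implicit Arguments.
Unset Strict Implicit.
Unset Printing Implicit Defensive.

Inductive op (U : Type) : Type :=
| Ins : U -> op U
| Del : U -> op U.

Definition present_step (U : finType) (S : {set U}) (o : op U) : {set U} :=
  match o with
  | Ins x => x |: S
  | Del x => S :\ x
  end.

Definition present (U : finType) (ops : seq (op U)) : {set U} :=
  foldl (@present_step U) set0 ops.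

Definition valid_step (U : finType) (n : nat) (S : {set U}) (o : op U) : bool :=
  match o with
  | Ins x => (x \notin S) && (#|x |: S| <= n)%N
  | Del x => x \in S
  end.

Fixpoint valid_from (U : finType) (n : nat) (S : {set U}) (ops : seq (op U))
    : bool :=
  match ops with
  | [::] => true
  | o :: ops' => valid_step n S o && valid_from n (present_step S o) ops'
  end.

Definition valid_ops (U : finType) (n : nat) (ops : seq (op U)) : bool :=
  valid_from n set0 ops.

Definition fb_step (U : finType) (m : nat) (H : {ffun U -> 'I_m}) (cap : nat)
    (st : {set U} * {set U}) (o : op U) : {set U} * {set U} :=
  let: (front, back) := st in
  match o with
  | Ins x =>
      if (#|[set y in front | H y == H x]| < cap)%N
      then (x |: front, back)
      else (front, x |: back)
  | Del x => (front :\ x, back :\ x)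
  end.

Definition fb_run (U : finType) (m : nat) (H : {ffun U -> 'I_m}) (cap : nat)
    (ops : seq (op U)) : {set U} * {set U} :=
  foldl (fb_step H cap) (set0, set0) ops.

Definition backyard_size (U : finType) (m : nat) (H : {ffun U -> 'I_m})
    (cap : nat) (ops : seq (op U)) (k : nat) : nat :=
  #|(fb_run H cap (take k ops)).2|.

Definition bin_capacity (h j : R) : nat :=
  Z.to_nat (Int_part (h + j * sqrt (h + 1) + 1)%R).

(* Probability, under a uniformly random hash function U -> 'I_m
   (i.e. independent uniform bins for all items), of an event. *)
Definition hash_prob (U : finType) (m : nat) (E : {ffun U -> 'I_m} -> bool) : R :=
  (INR #|[set H : {ffun U -> 'I_m} | E H]| / INR #|{ffun U -> 'I_m}|)%R.

Definition Rltb (x y : R) : bool := if Rlt_dec x y then true else false.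

(* Main.v *)
(* For a fixed moment, let P be the set of present items and S x the set of
   items present when x was last inserted. An item of P in the backyard hashed
   to a bin containing at least cap items of S x; let B count such items.
   B depends on the hash values of arbitrarily many departed items, so a single
   bounded difference inequality does not suffice. Instead, B is truncated at K
   per bin, which makes every item of P have influence at most K, and the moment
   generating function is first averaged over the hash values of P. What remains
   is controlled by the sum over x in P of the fraction of bins full for S x,
   in which y has influence #{x in P | y in S x} / m; the squares of these sum
   to at most n h^2. By a Chernoff bound each fraction has expectation at most
   exp(-j^2/8). Both fluctuations are O(K sqrt(n log n)) with K = O(h + log n),
   and a union bound over the moments concludes. If m > n then j < 1 and the
   claimed bound exceeds n. *)
From Stdlib Require Znat.
From Stdlib Require Import Lra.
From HB Require Import structures.
Require Import Defs.
From mathcomp Require Import all_boot.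
From Stdlib Require Import Reals.

Set Implicit Arguments.
Unset Strict Implicit.
Unset Printing Implicit Defensive.

Local Open Scope R_scope.

(** * Real sums as big operators, and elementary inequalities for [exp] *)

Lemma RplusA : associative Rplus. Proof. by move=> x y z; ring. Qed.
Lemma RmultDl : left_distributive Rmult Rplus. Proof. by move=> x y z; ring. Qed.
Lemma RmultDr : right_distributive Rmult Rplus. Proof. by move=> x y z; ring. Qed.

HB.instance Definition _ :=
  Monoid.isComLaw.Build R 0 Rplus RplusA Rplus_comm Rplus_0_l.
HB.instance Definition _ :=
  Monoid.isMulLaw.Build R 0 Rmult Rmult_0_l Rmult_0_r.
HB.instance Definition _ :=
  Monoid.isAddLaw.Build R Rmult Rplus RmultDl RmultDr.

Local Notation "\rsum_ ( i : T ) F" := (\big[Rplus/0%R]_(i : T) F%R)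
  (at level 41, F at level 41, i at level 50) : R_scope.
Local Notation "\rsum_ ( i 'in' A ) F" := (\big[Rplus/0%R]_(i in A) F%R)
  (at level 41, F at level 41, i, A at level 50) : R_scope.
Local Notation "\rsum_ ( i <- s ) F" := (\big[Rplus/0%R]_(i <- s) F%R)
  (at level 41, F at level 41, i, s at level 50) : R_scope.

Section RealSums.
Variables (I : Type) (r : seq I) (P : pred I).

Lemma rsum_le (F G : I -> R) : (forall i, P i -> F i <= G i) ->
  \big[Rplus/0]_(i <- r | P i) F i <= \big[Rplus/0]_(i <- r | P i) G i.
Proof.
move=> FG; apply: (big_ind2 Rle) => //; first exact: Rle_refl.
by move=> *; apply: Rplus_le_compat.
Qed.

Lemma rsum_ge0 (F : I -> R) : (forall i, P i -> 0 <= F i) ->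
  0 <= \big[Rplus/0]_(i <- r | P i) F i.
Proof. by move=> F0; apply: (big_ind (Rle 0)) => // [|x y]; lra. Qed.

Lemma INR_sum (F : I -> nat) :
  INR (\sum_(i <- r | P i) F i)%nat = \big[Rplus/0]_(i <- r | P i) INR (F i).
Proof. by apply: (big_morph INR) => // x y; rewrite -plus_INR. Qed.

End RealSums.

Lemma rsum_const (I : finType) (A : {pred I}) (c : R) :
  \rsum_(i in A) c = INR #|A| * c.
Proof.
rewrite big_const; elim: #|A| => [|k IH]; first by rewrite /=; ring.
by rewrite iterS IH S_INR; ring.
Qed.

Lemma rsum_le_const (I : finType) (A : {pred I}) (F : I -> R) (c : R) :
  (forall i, i \in A -> F i <= c) -> \rsum_(i in A) F i <= INR #|A| * c.
Proof. by move=> Fc; rewrite -rsum_const; apply: rsum_le. Qed.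

Lemma INR_leq (a b : nat) : (a <= b)%nat -> INR a <= INR b.
Proof. by move=> ab; apply: le_INR; apply/leP. Qed.

Lemma INR_card (I : finType) (A : {pred I}) (p : pred I) :
  INR #|[set x in A | p x]| = \rsum_(x in A) INR (p x).
Proof.
rewrite -INR_sum -sum1_card big_mkcond [in RHS]big_mkcond; congr INR.
by apply: eq_bigr => x _; rewrite inE; case: (x \in A); case: (p x).
Qed.

Lemma exp_increasing_le (x y : R) : x <= y -> exp x <= exp y.
Proof. by case=> [xy|->]; [left; apply: exp_increasing | right]. Qed.

Lemma one_plus_le_exp (x : R) : 1 + x <= exp x.
Proof.
case: (Req_dec x 0) => [->|x0]; first by rewrite exp_0; lra.
by left; apply: exp_ineq1.
Qed.

(** From [1 - x <= exp (- x)] follows [exp x * (1 - x) <= 1], while the claimed bound times [1 - x]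
    equals [1 + x ^ 2 * (1 - 2 * x)], which is at least 1. *)
Lemma exp_le_quadratic (x : R) : x <= / 2 -> exp x <= 1 + x + 2 * x ^ 2.
Proof.
move=> hx; have h1 := one_plus_le_exp (- x); have h2 := exp_pos x.
have h3 : exp x * exp (- x) = 1 by rewrite -exp_plus Rplus_opp_r exp_0.
have h4 : exp x * (1 - x) <= 1 by nra.
have h5 : 1 <= (1 + x + 2 * x ^ 2) * (1 - x) by nra.
apply: (Rmult_le_reg_r (1 - x)); lra.
Qed.

(** * Conditional expectation by resampling, and bounded differences *)

Section Resampling.
Variables (U : finType) (m : nat).
Hypothesis m_gt0 : (0 < m)%nat.
Implicit Types (H : {ffun U -> 'I_m}) (f g : {ffun U -> 'I_m} -> R).
Implicit Types (x y : U) (s : seq U) (P S : {set U}).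

Let mR_gt0 : 0 < INR m. Proof. by apply: lt_0_INR; apply/ltP. Qed.

Definition upd H x (v : 'I_m) : {ffun U -> 'I_m} :=
  [ffun y => if y == x then v else H y].

(** The conditional expectation of [f] given all hash values except that of [x], kept as a function
    of the whole of [H] so that such averages compose. *)
Definition avg1 x f H := \rsum_(v : 'I_m) f (upd H x v) / INR m.

Definition avgs s f := foldr avg1 f s.

Definition expectation f :=
  (\rsum_(H : {ffun U -> 'I_m}) f H) / INR #|{ffun U -> 'I_m}|.

(** Since [v] and [w] may be exchanged, this bounds the influence of [x] in absolute value. *)
Definition bounded_diff f x (c : R) :=
  forall H v w, f (upd H x v) - f (upd H x w) <= c.

Lemma updd H x v w : upd (upd H x v) x w = upd H x w.
Proof. by apply/ffunP => y; rewrite !ffunE; case: eqP. Qed.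

Lemma updC H x y v w : x != y -> upd (upd H x v) y w = upd (upd H y w) x v.
Proof.
move=> xy; apply/ffunP => z; rewrite !ffunE.
by case: (z =P y) => // ->; rewrite eq_sym (negbTE xy).
Qed.

Lemma upd_id H x : upd H x (H x) = H.
Proof. by apply/ffunP => z; rewrite !ffunE; case: eqP => // ->. Qed.

Lemma avg1_le x f g H : (forall H', f H' <= g H') -> avg1 x f H <= avg1 x g H.
Proof.
move=> fg; apply: rsum_le => v _; apply: Rmult_le_compat_r => //.
by left; apply: Rinv_0_lt_compat.
Qed.

Lemma eq_avg1 x f g H : (forall H', f H' = g H') -> avg1 x f H = avg1 x g H.
Proof. by move=> fg; apply: eq_bigr => v _; rewrite fg. Qed.

Lemma avg1_cst x (c : R) H : avg1 x (fun=> c) H = c.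
Proof. by rewrite /avg1 rsum_const card_ord; field; lra. Qed.

Lemma avg1D x f g H : avg1 x (fun H => f H + g H) H = avg1 x f H + avg1 x g H.
Proof. by rewrite /avg1 -big_split; apply: eq_bigr => v _ /=; field; lra. Qed.

Lemma avg1Z x (c : R) f H : avg1 x (fun H => c * f H) H = c * avg1 x f H.
Proof. by rewrite /avg1 big_distrr; apply: eq_bigr => v _ /=; field; lra. Qed.

Lemma avg1C x y f H : avg1 x (avg1 y f) H = avg1 y (avg1 x f) H.
Proof.
have [->//|xy] := eqVneq x y.
transitivity (\rsum_(v : 'I_m) \rsum_(w : 'I_m)
    f (upd (upd H x v) y w) / INR m / INR m).
  by apply: eq_bigr => v _; rewrite /Rdiv big_distrl.
rewrite exchange_big; apply: eq_bigr => w _.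
rewrite /avg1 /Rdiv big_distrl; apply: eq_bigr => v _ /=.
by rewrite updC.
Qed.

Lemma avg1_upd x f H v : avg1 x f (upd H x v) = avg1 x f H.
Proof. by apply: eq_bigr => w _; rewrite updd. Qed.

Lemma avg1_idem x f H : avg1 x (avg1 x f) H = avg1 x f H.
Proof.
rewrite -[RHS](avg1_cst x _ H) [LHS]/avg1; apply: eq_bigr => v _.
by rewrite avg1_upd.
Qed.

Lemma avgs_le s f g H : (forall H', f H' <= g H') -> avgs s f H <= avgs s g H.
Proof. by move=> fg; elim: s H => //= x s IH H; apply: avg1_le. Qed.

Lemma eq_avgs s f g H : (forall H', f H' = g H') -> avgs s f H = avgs s g H.
Proof. by move=> fg; elim: s H => //= x s IH H; apply: eq_avg1. Qed.

Lemma avgsD s f g H :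
  avgs s (fun H => f H + g H) H = avgs s f H + avgs s g H.
Proof.
elim: s H => //= x s IH H; rewrite -avg1D; exact: eq_avg1.
Qed.

Lemma avgs_cst s (c : R) H : avgs s (fun=> c) H = c.
Proof. by elim: s H => //= x s IH H; rewrite (eq_avg1 _ _ IH) avg1_cst. Qed.

Lemma avgsZ s (c : R) f H : avgs s (fun H => c * f H) H = c * avgs s f H.
Proof. by elim: s H => //= x s IH H; rewrite (eq_avg1 _ _ IH) avg1Z. Qed.

Lemma avgs_sum s (I : Type) (r : seq I) (p : pred I)
    (F : I -> {ffun U -> 'I_m} -> R) H :
  avgs s (fun H => \big[Rplus/0]_(i <- r | p i) F i H) H =
  \big[Rplus/0]_(i <- r | p i) avgs s (F i) H.
Proof.
elim: r => [|i r IH].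
  by rewrite big_nil -[RHS](avgs_cst s 0 H); apply: eq_avgs => H'; rewrite big_nil.
rewrite big_cons -IH; case: ifP => pi.
  by rewrite -avgsD; apply: eq_avgs => H'; rewrite big_cons pi.
by apply: eq_avgs => H'; rewrite big_cons pi.
Qed.

Lemma avgs_avg1C s x f H : avgs s (avg1 x f) H = avg1 x (avgs s f) H.
Proof.
elim: s H => //= y s IH H; rewrite avg1C; exact: eq_avg1.
Qed.

(** Tower property: single averages commute and are idempotent, so the extra one merges with the one
    for [x] already made by [s]. *)
Lemma avgs_absorb s x f H : x \in s -> avgs s (avg1 x f) H = avgs s f H.
Proof.
elim: s H => //= y s IH H; rewrite inE; case: (x =P y) => [<- _|_ /= xs].
  by rewrite -[RHS]avg1_idem; apply: eq_avg1 => H'; apply: avgs_avg1C.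
by apply: eq_avg1 => H'; apply: IH.
Qed.

(** Resampling overwrites every hash value in [s]. When [s] lists all of [U], the average is
    therefore constant, which identifies it with the expectation. *)
Lemma avgs_agree s f H H' :
  (forall y, y \notin s -> H y = H' y) -> avgs s f H = avgs s f H'.
Proof.
elim: s H H' => [|x s IH] H H' HH' /=.
  by congr f; apply/ffunP => y; apply: HH'.
apply: eq_bigr => v _; congr (_ / _); apply: IH => y ys; rewrite !ffunE.
by case: eqP => // /eqP yx; apply: HH'; rewrite inE negb_or yx.
Qed.

Lemma card_hash_gt0 : 0 < INR #|{ffun U -> 'I_m}|.
Proof.
by apply: lt_0_INR; apply/ltP; rewrite card_ffun card_ord expn_gt0 m_gt0.
Qed.

Lemma expectation_le f g : (forall H, f H <= g H) ->
  expectation f <= expectation g.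
Proof.
move=> fg; apply: Rmult_le_compat_r; last exact: rsum_le.
by left; apply: Rinv_0_lt_compat; apply: card_hash_gt0.
Qed.

Lemma eq_expectation f g : (forall H, f H = g H) ->
  expectation f = expectation g.
Proof. by move=> fg; congr (_ / _); apply: eq_bigr => H _. Qed.

Lemma expectation_cst (c : R) : expectation (fun=> c) = c.
Proof.
have := card_hash_gt0; set N := INR _ => N_gt0.
rewrite /expectation (_ : \rsum_(H : {ffun U -> 'I_m}) c = N * c).
  by rewrite -/N; field; lra.
by rewrite rsum_const; congr (INR _ * _); apply: eq_card.
Qed.

Lemma expectationD f g :
  expectation (fun H => f H + g H) = expectation f + expectation g.
Proof. by rewrite /expectation big_split /= /Rdiv Rmult_plus_distr_r. Qed.

Lemma expectationZ (c : R) f :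
  expectation (fun H => c * f H) = c * expectation f.
Proof. by rewrite /expectation -big_distrr /= /Rdiv Rmult_assoc. Qed.

Lemma expectation_sum (I : Type) (r : seq I) (p : pred I)
    (F : I -> {ffun U -> 'I_m} -> R) :
  expectation (fun H => \big[Rplus/0]_(i <- r | p i) F i H) =
  \big[Rplus/0]_(i <- r | p i) expectation (F i).
Proof. by rewrite /expectation exchange_big /= /Rdiv big_distrl. Qed.

(* The swap (H, v) |-> (upd H x v, H x) is an involution. *)
Lemma expectation_avg1 x f : expectation (avg1 x f) = expectation f.
Proof.
congr (_ / _); rewrite /avg1 pair_big /=.
pose swp (p : {ffun U -> 'I_m} * 'I_m) := (upd p.1 x p.2, p.1 x).
have swpK : involutive swp.
  by move=> [H v]; rewrite /swp /= updd upd_id ffunE eqxx.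
rewrite (reindex_inj (inv_inj swpK)) /=.
transitivity (\rsum_(p : {ffun U -> 'I_m} * 'I_m) f p.1 / INR m).
  by apply: eq_bigr => -[H v] _ /=; rewrite updd upd_id.
rewrite -(pair_big xpredT xpredT (fun H (v : 'I_m) => f H / INR m)) /=.
by apply: eq_bigr => H _; rewrite rsum_const card_ord; field; lra.
Qed.

Lemma expectation_avgs s f : expectation (avgs s f) = expectation f.
Proof. by elim: s => //= x s IH; rewrite expectation_avg1. Qed.

Lemma avgs_enum f H : avgs (enum U) f H = expectation f.
Proof.
rewrite -(expectation_avgs (enum U)) -[LHS]expectation_cst.
by apply: eq_expectation => H'; apply: avgs_agree => y; rewrite mem_enum.
Qed.

Lemma bounded_diff_avg1 f x y c :
  bounded_diff f x c -> bounded_diff (avg1 y f) x c.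
Proof.
move=> fc H v w; have [->|xy] := eqVneq y x.
  rewrite !avg1_upd; have := fc H v v; lra.
suff: avg1 y f (upd H x v) <= avg1 y f (upd H x w) + c by lra.
rewrite -(avg1_cst y c (upd H x w)) -avg1D; apply: rsum_le => u _.
apply: Rmult_le_compat_r; first by left; apply: Rinv_0_lt_compat.
rewrite !(updC H _ u (_ : x != y)) 1?eq_sym //; have := fc (upd H y u) v w; lra.
Qed.

Lemma bounded_diff_avgs f x s c :
  bounded_diff f x c -> bounded_diff (avgs s f) x c.
Proof. by move=> fc; elim: s => //= y s; apply: bounded_diff_avg1. Qed.

(** A Hoeffding-type lemma with a cruder constant: all values lie within [c] of their average, and
    the linear term of the quadratic bound on [exp] averages out. *)
Lemma avg1_exp_le x f c H : c <= / 2 -> bounded_diff f x c ->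
  avg1 x (fun H => exp (f H)) H <= exp (avg1 x f H + 2 * c ^ 2).
Proof.
move=> c2 fc; set a := avg1 x f H.
have dev v : - c <= f (upd H x v) - a <= c.
  have E w : avg1 x (fun=> w) H = w by exact: avg1_cst.
  split.
    suff: a <= f (upd H x v) + c by lra.
    rewrite -[X in _ <= X]E; apply: rsum_le => w _; apply: Rmult_le_compat_r.
      by left; apply: Rinv_0_lt_compat.
    have := fc H w v; lra.
  suff: f (upd H x v) - c <= a by lra.
  rewrite -[X in X <= _]E; apply: rsum_le => w _; apply: Rmult_le_compat_r.
    by left; apply: Rinv_0_lt_compat.
  have := fc H v w; lra.
apply: (Rle_trans _ (exp a * (1 + 2 * c ^ 2))); last first.
  by rewrite exp_plus; apply: Rmult_le_compat_l;
    [left; apply: exp_pos | apply: one_plus_le_exp].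
apply: (Rle_trans _
  (avg1 x (fun H' => exp a * (1 - a + 2 * c ^ 2) + exp a * f H') H)); last first.
  by rewrite avg1D avg1_cst avg1Z -/a; right; ring.
apply: rsum_le => v _; apply: Rmult_le_compat_r.
  by left; apply: Rinv_0_lt_compat.
set z := f _; have zE : z = a + (z - a) by ring.
have [z1 z2] := dev v; rewrite -/z in z1 z2.
rewrite {1}zE exp_plus -Rmult_plus_distr_l.
apply: Rmult_le_compat_l; first by left; apply: exp_pos.
apply: Rle_trans (exp_le_quadratic _) _; first lra.
have : (z - a) ^ 2 <= c ^ 2 by nra.
lra.
Qed.

(** The exponential form of McDiarmid's inequality: items are averaged out one at a time, and
    averaging does not increase the influence of the remaining ones. *)
Lemma avgs_exp_le s f (c : U -> R) H :
  (forall x, x \in s -> c x <= / 2) ->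
  (forall x, x \in s -> bounded_diff f x (c x)) ->
  avgs s (fun H => exp (f H)) H <=
  exp (avgs s f H + 2 * \rsum_(x <- s) c x ^ 2).
Proof.
elim: s H => [|x s IH] H c2 fc /=.
  by rewrite big_nil; apply: exp_increasing_le; lra.
rewrite big_cons; set C := \rsum_(x <- s) _.
apply: (Rle_trans _ (avg1 x (fun H => exp (2 * C) * exp (avgs s f H)) H)).
  apply: avg1_le => H'; rewrite -exp_plus Rplus_comm; apply: IH => y ys.
    by apply: c2; rewrite inE ys orbT.
  by apply: fc; rewrite inE ys orbT.
rewrite avg1Z; apply: (Rle_trans _
  (exp (2 * C) * exp (avg1 x (avgs s f) H + 2 * c x ^ 2))).
  apply: Rmult_le_compat_l; first by left; apply: exp_pos.
  apply: avg1_exp_le; first by apply: c2; rewrite inE eqxx.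
  by apply: bounded_diff_avgs; apply: fc; rewrite inE eqxx.
by rewrite -exp_plus; apply: exp_increasing_le; lra.
Qed.

Lemma expectation_exp_le f (c : U -> R) :
  (forall x, c x <= / 2) -> (forall x, bounded_diff f x (c x)) ->
  expectation (fun H => exp (f H)) <=
  exp (expectation f + 2 * \rsum_(x : U) c x ^ 2).
Proof.
move=> c2 fc; rewrite -(expectation_avgs (enum U)).
rewrite -[X in _ <= X]expectation_cst; apply: expectation_le => H.
rewrite -(avgs_enum f H) -[\rsum_(x : U) _]big_enum.
exact: avgs_exp_le.
Qed.

End Resampling.

(** * Loads of single bins and Chernoff bounds *)

Section BinLoads.
Variables (U : finType) (m : nat).
Hypothesis m_gt0 : (0 < m)%nat.
Implicit Types (H : {ffun U -> 'I_m}) (x y : U) (S A B : {set U}).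

Let mR_gt0 : 0 < INR m. Proof. by apply: lt_0_INR; apply/ltP. Qed.

Definition bin H (b : 'I_m) : {set U} := [set y | H y == b].

Lemma bin_upd S H x v b : x \notin S -> S :&: bin (upd H x v) b = S :&: bin H b.
Proof.
move=> xS; apply/setP => y; rewrite !inE ffunE.
by case: (y =P x) => // ->; rewrite (negbTE xS).
Qed.

(* Moving a single item shrinks one bin and enlarges another one, so the two
   changes have opposite signs. *)
Lemma bounded_diff_bins (phi : {set U} -> R) (K : R) x :
  (forall A B, A \subset B -> phi A <= phi B) ->
  (forall A, 0 <= phi A <= K) ->
  bounded_diff (fun H => \rsum_(b : 'I_m) phi (bin H b)) x K.
Proof.
move=> phi_mono phiK H v w; rewrite (bigD1 v) //= [X in _ - X](bigD1 v) //=.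
have h1 := phiK (bin (upd H x v) v); have h2 := phiK (bin (upd H x w) v).
set X := \big[_/_]_(i | _) _; set Y := \big[_/_]_(i | _) _.
suff: X <= Y by lra.
apply: rsum_le => b bv; apply: phi_mono; apply/subsetP => y.
rewrite !inE !ffunE; case: (y =P x) => // _.
by rewrite eq_sym (negbTE bv).
Qed.

Lemma bounded_diffZ (f : {ffun U -> 'I_m} -> R) x (a c : R) : 0 <= a ->
  bounded_diff f x c -> bounded_diff (fun H => a * f H) x (a * c).
Proof. by move=> a0 fc H v w; have := fc H v w; nra. Qed.

Lemma bounded_diff_sum (I : finType) (P : {pred I})
    (F : I -> {ffun U -> 'I_m} -> R) (c : I -> R) x :
  (forall i, i \in P -> bounded_diff (F i) x (c i)) ->
  bounded_diff (fun H => \rsum_(i in P) F i H) x (\rsum_(i in P) c i).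
Proof.
move=> Fc H v w.
suff: \rsum_(i in P) F i (upd H x v) <=
      \rsum_(i in P) F i (upd H x w) + \rsum_(i in P) c i by lra.
rewrite -big_split /=; apply: rsum_le => i iP.
by have := Fc i iP H v w; lra.
Qed.

(** The exponential moment of a binomial load, by induction on [S]: each item contributes a factor
    [1 + (exp l - 1) / m], at most [exp ((exp l - 1) / m)]. *)
Lemma expectation_exp_load (l : R) S b : 0 <= l ->
  expectation (fun H => exp (l * INR #|S :&: bin H b|)) <=
  exp (INR #|S| / INR m * (exp l - 1)).
Proof.
move=> l0.
have el : 0 <= exp l - 1 by have := one_plus_le_exp l; lra.
have [k] := ubnP #|S|; elim: k S => // k IH S Sk.
have [->|[y yS]] := set_0Vmem S.
  rewrite cards0 (eq_expectation (g := fun=> 1)) ?expectation_cst //.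
    by rewrite /= /Rdiv !Rmult_0_l exp_0; apply: Rle_refl.
  by move=> H; rewrite set0I cards0 /= Rmult_0_r exp_0.
rewrite -(expectation_avg1 m_gt0 y).
(* Averaging over the bin of [y]: exactly one of the [m] values is [b], and it multiplies the
   exponential by [exp l]. *)
rewrite (eq_expectation (g := fun H =>
  (1 + (exp l - 1) / INR m) * exp (l * INR #|(S :\ y) :&: bin H b|))); last first.
  move=> H; set e := exp (l * _).
  transitivity (\rsum_(v : 'I_m)
      (e / INR m + (if v == b then (exp l - 1) * e / INR m else 0))).
    apply: eq_bigr => v _.
    rewrite (cardsD1 y) (_ : (_ :&: _) :\ y = (S :\ y) :&: bin H b); last first.
      apply/setP => z; rewrite !inE ffunE.
      by case: eqP.
    rewrite !inE yS ffunE eqxx /= -plusE plus_INR Rmult_plus_distr_l exp_plus -/e.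
    by case: eqP => _; rewrite /= ?Rmult_1_r ?Rmult_0_r ?exp_0; field; lra.
  rewrite big_split /= rsum_const card_ord -big_mkcond big_pred1_eq.
  by field; lra.
rewrite expectationZ.
have SE : INR #|S| = 1 + INR #|S :\ y|.
  by rewrite (cardsD1 y) yS -plusE plus_INR.
have lt_k : (#|S :\ y| < k)%nat by move: Sk; rewrite (cardsD1 y) yS.
rewrite (_ : INR #|S| / INR m * (exp l - 1) =
  (exp l - 1) / INR m + INR #|S :\ y| / INR m * (exp l - 1)); last first.
  by rewrite SE; field; lra.
rewrite exp_plus; apply: Rmult_le_compat.
- have : 0 <= (exp l - 1) / INR m.
    by apply: Rmult_le_pos => //; left; apply: Rinv_0_lt_compat.
  lra.
- rewrite -[X in X <= _](expectation_cst U m_gt0 0).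
  by apply: expectation_le => // H; left; apply: exp_pos.
- exact: one_plus_le_exp.
- exact: IH.
Qed.

(** The exponential dominates the indicator of a load of at least [t]. Besides full bins, this
    serves with [l = 1/2] for bins that receive too many present items. *)
Lemma expectation_load_tail (l t : R) (n : nat) S b : 0 <= l <= / 2 ->
  (#|S| <= n)%nat ->
  expectation (fun H => exp (l * (INR #|S :&: bin H b| - t))) <=
  exp (INR n / INR m * (l + 2 * l ^ 2) - l * t).
Proof.
move=> [l0 l2] Sn.
rewrite (eq_expectation (g := fun H =>
   exp (- (l * t)) * exp (l * INR #|S :&: bin H b|))); last first.
  by move=> H; rewrite -exp_plus; congr exp; ring.
rewrite expectationZ /Rminus Rplus_comm exp_plus.
apply: Rmult_le_compat_l; first by left; apply: exp_pos.
apply: Rle_trans (expectation_exp_load _ _ l0) _; apply: exp_increasing_le.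
have := exp_le_quadratic l2; have := one_plus_le_exp l => h1 h2.
apply: Rmult_le_compat; try lra.
- apply: Rmult_le_pos; first exact: pos_INR.
  by left; apply: Rinv_0_lt_compat.
- apply: Rmult_le_compat_r; last exact: INR_leq.
  by left; apply: Rinv_0_lt_compat.
Qed.

Lemma chernoff_full_bin (n cap : nat) (j : R) S b :
  let h := INR n / INR m in
  0 < j <= sqrt h -> h + j * sqrt h <= INR cap -> (#|S| <= n)%nat ->
  expectation (fun H => INR (cap <= #|S :&: bin H b|)%nat) <= exp (- (j ^ 2 / 8)).
Proof.
move=> h [j0 jh] hcap Sn.
have s0 : 0 < sqrt h by lra.
have hh : h = sqrt h * sqrt h.
  rewrite sqrt_sqrt //; case: (Rle_lt_dec 0 h) => // hneg.
  by rewrite sqrt_neg_0 in s0; lra.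
(* The minimiser of the exponent [2 * h * l ^ 2 - l * j * sqrt h], with minimum [- j ^ 2 / 8];
   [j <= sqrt h] keeps it at most [1/4]. *)
pose l := j / (4 * sqrt h).
have lE : l * (4 * sqrt h) = j by rewrite /l; field; lra.
have l0 : 0 < l.
  by apply: Rmult_lt_0_compat => //; apply: Rinv_0_lt_compat; lra.
have l2 : l <= / 2 by nra.
apply: (Rle_trans _ (expectation (fun H =>
   exp (l * (INR #|S :&: bin H b| - (h + j * sqrt h)))))).
  apply: expectation_le => // H.
  case: leqP => /= [le_cap|_]; last by left; apply: exp_pos.
  rewrite -exp_0; apply: exp_increasing_le; apply: Rmult_le_pos; first lra.
  by have := INR_leq le_cap; lra.
apply: Rle_trans (expectation_load_tail _ _ _ Sn) _; first lra.
apply: exp_increasing_le; rewrite -/h; right.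
have key s a k : a = s * s -> k * (4 * s) = j ->
    a * (k + 2 * k ^ 2) - k * (a + j * s) = - (j ^ 2 / 8) by move=> -> <-; field.
exact: key.
Qed.

End BinLoads.

(** * Overflow at one moment, for fixed snapshots [S x] *)

Section Overflow.
Variables (U : finType) (m n cap : nat) (P : {set U}) (S : U -> {set U}).
Hypotheses (m_gt0 : (0 < m)%nat) (Pn : (#|P| <= n)%nat).
Hypotheses (S_irr : forall x, x \notin S x) (Sn : forall x, (#|S x| <= n)%nat).
Implicit Types (H : {ffun U -> 'I_m}) (x y : U) (A B : {set U}).

Let mR_gt0 : 0 < INR m. Proof. by apply: lt_0_INR; apply/ltP. Qed.

(** The bin enters as an arbitrary set [A], so that monotonicity in [A] can feed
    [bounded_diff_bins]. *)
Definition full A x := (cap <= #|S x :&: A|)%nat.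

Definition bin_overflow A := #|[set x in P :&: A | full A x]|.

(** A static upper bound for the backyard: loads count all items of a snapshot, whether they sit in
    the front yard or not, so no history of placements enters. *)
Definition overflow H := #|[set x in P | full (bin H (H x)) x]|.

Definition truncated_overflow (K : R) H :=
  \rsum_(b : 'I_m) Rmin (INR (bin_overflow (bin H b))) K.

Definition full_fraction x H := \rsum_(b : 'I_m) INR (full (bin H b) x) / INR m.

Lemma full_mono A B x : A \subset B -> full A x -> full B x.
Proof.
by move=> AB fA; apply: leq_trans fA _; apply: subset_leq_card; apply: setIS.
Qed.

Lemma overflow_bins H : INR (overflow H) = \rsum_(b : 'I_m) INR (bin_overflow (bin H b)).
Proof.
rewrite -INR_sum; congr INR; rewrite /overflow -sum1_card.
rewrite (partition_big H xpredT) //=; apply: eq_bigr => b _.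
rewrite /bin_overflow -sum1_card; apply: eq_bigl => x; rewrite !inE.
by case: eqP => [->|]; rewrite ?andbT ?andbF.
Qed.

Lemma truncated_overflow_le K H : truncated_overflow K H <= INR (overflow H).
Proof. by rewrite overflow_bins; apply: rsum_le => b _; apply: Rmin_l. Qed.

Lemma truncated_overflow_eq K H :
  (forall b, INR #|P :&: bin H b| <= K) ->
  truncated_overflow K H = INR (overflow H).
Proof.
move=> PK; rewrite overflow_bins; apply: eq_bigr => b _; apply: Rmin_left.
apply: Rle_trans (PK b); apply: INR_leq; apply: subset_leq_card.
by apply/subsetP => x; rewrite inE => /andP[].
Qed.

(** Moving [x] may change the fullness of a bin for many other items at once; the truncation caps
    this effect at [K]. *)
Lemma bounded_diff_truncated_overflow K x : 0 <= K ->
  bounded_diff (truncated_overflow K) x K.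
Proof.
move=> K0; apply: (bounded_diff_bins (phi := fun A => Rmin (INR (bin_overflow A)) K)).
  move=> A B AB; apply: Rle_min_compat_r; apply: INR_leq.
  apply: subset_leq_card; apply/subsetP => y.
  rewrite !inE => /andP[/andP[-> yA] fA] /=.
  by rewrite (subsetP AB) //= (full_mono AB).
move=> A; split; last exact: Rmin_r.
by apply: Rmin_glb => //; apply: pos_INR.
Qed.

(** An item outside the snapshot leaves all its loads unchanged. For one inside, fullness is
    monotone in the bin and each bin weighs at most [1 / m]. *)
Lemma bounded_diff_full_fraction x y :
  bounded_diff (full_fraction x) y (INR (y \in S x) / INR m).
Proof.
have im : 0 < / INR m by apply: Rinv_0_lt_compat.
have [yS|yS] := boolP (y \in S x); last first.
  move=> H v w; rewrite /full_fraction /full.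
  under eq_bigr do rewrite bin_upd //.
  under [X in _ - X]eq_bigr do rewrite bin_upd //.
  by rewrite /Rdiv Rmult_0_l; lra.
apply: (bounded_diff_bins (phi := fun A => INR (full A x) / INR m)).
  move=> A B AB; apply: Rmult_le_compat_r; first lra.
  have := full_mono AB (x := x); case: (full A x) => [->//|_ /=]; first lra.
  exact: pos_INR.
move=> A; rewrite /Rdiv; case: (full A x) => /=; lra.
Qed.

(** As [x] is not in [S x], resampling it leaves the relevant loads alone and merely selects a
    uniform bin. *)
Lemma avg1_full x H :
  avg1 x (fun H => INR (full (bin H (H x)) x)) H = full_fraction x H.
Proof.
by apply: eq_bigr => v _; rewrite ffunE eqxx /full bin_upd.
Qed.

(** Truncation only lowers the count. Each remaining indicator belongs to some [x] in [P], so by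
    absorption it may first be averaged over [x] itself. *)
Lemma avgs_truncated_overflow_le K H :
  avgs (enum P) (truncated_overflow K) H <=
  avgs (enum P) (fun H => \rsum_(x in P) full_fraction x H) H.
Proof.
apply: Rle_trans (avgs_le m_gt0 _ _ (truncated_overflow_le K)) _.
rewrite (eq_avgs _ (g := fun H => \rsum_(x in P) INR (full (bin H (H x)) x))); last first.
  by move=> H'; rewrite -INR_card.
rewrite !(avgs_sum m_gt0); apply: rsum_le => x xP; right.
rewrite -(avgs_absorb m_gt0 (x := x)) ?mem_enum //.
by apply: eq_avgs => H'; apply: avg1_full.
Qed.

Let h := INR n / INR m.

(** [occ y / m] bounds the influence of [y] on the sum of the full fractions over [P]. *)
Definition occ y := \rsum_(x in P) INR (y \in S x).

Lemma occ_le y : occ y <= INR n.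
Proof.
apply: Rle_trans (rsum_le_const (c := 1) _) _.
  by move=> x _; case: (y \in S x) => /=; lra.
by rewrite Rmult_1_r; apply: INR_leq.
Qed.

(** Each [occ y] is at most [n], and double counting bounds their sum by [n ^ 2]: at most [n]
    snapshots of at most [n] items. *)
Lemma sum_occ : \rsum_(y : U) occ y ^ 2 <= INR n ^ 3.
Proof.
have n0 := pos_INR n.
have occ0 y : 0 <= occ y by apply: rsum_ge0 => x _; apply: pos_INR.
apply: (Rle_trans _ (\rsum_(y : U) INR n * occ y)).
  by apply: rsum_le => y _; have := occ0 y; have := occ_le y; nra.
rewrite -big_distrr /= exchange_big /=.
suff : \rsum_(x in P) \rsum_(y : U) INR (y \in S x) <= INR n * INR n by nra.
apply: (Rle_trans _ (INR #|P| * INR n)); last first.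
  by apply: Rmult_le_compat_r => //; apply: INR_leq.
apply: rsum_le_const => x _; rewrite -INR_sum; apply: INR_leq.
apply: leq_trans (Sn x); rewrite -sum1_card [X in (_ <= X)%nat]big_mkcond /=.
by apply: leq_sum => y _; case: (y \in S x).
Qed.

(* The history of the departed items involves far too many hash values for a
   direct bounded difference estimate. Averaging over the items of P first
   leaves a sum of fractions of full bins, each of which involves at most n
   hash values, each with influence 1/m. *)
Lemma truncated_overflow_mgf (l K q : R) : 0 <= l -> l * K <= / 2 -> h <= K ->
  0 <= q -> (forall x b, expectation (fun H => INR (full (bin H b) x)) <= q) ->
  expectation (fun H => exp (l * truncated_overflow K H)) <=
  exp (l * (INR n * q) + 4 * l ^ 2 * INR n * K ^ 2).
Proof.
move=> l0 lK hK q0 fq.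
have n0 := pos_INR n.
have im : 0 < / INR m by apply: Rinv_0_lt_compat.
have h0 : 0 <= h by apply: Rmult_le_pos => //; lra.
have K0 : 0 <= K by lra.
pose W H := \rsum_(x in P) full_fraction x H.
have W_diff y : bounded_diff W y (occ y / INR m).
  rewrite /occ /Rdiv big_distrl /=; apply: bounded_diff_sum => x _.
  exact: bounded_diff_full_fraction.
have EW : expectation W <= INR n * q.
  rewrite expectation_sum.
  apply: (Rle_trans _ (\rsum_(x in P) q)); last first.
    by rewrite rsum_const; apply: Rmult_le_compat_r => //; apply: INR_leq.
  apply: rsum_le => x _; rewrite /full_fraction expectation_sum.
  apply: Rle_trans (rsum_le_const (c := q / INR m) _) _ => [b _|].
    rewrite (eq_expectation (g := fun H => / INR m * INR (full (bin H b) x))).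
      by rewrite expectationZ; have := fq x b; rewrite /Rdiv; nra.
    by move=> H; rewrite /Rdiv Rmult_comm.
  by rewrite card_ord; right; field; lra.
rewrite -(expectation_avgs m_gt0 (enum P)).
(* First round: at most [n] items of [P], each of influence [l * K], give the constant factor. *)
apply: (Rle_trans _ (expectation (fun H =>
   exp (2 * (INR n * (l * K) ^ 2)) * exp (avgs (enum P) (fun H => l * W H) H)))).
  apply: expectation_le => // H; rewrite -exp_plus.
  apply: Rle_trans (avgs_exp_le m_gt0 (c := fun=> l * K) _ _ _) _ => //.
    move=> x _; apply: bounded_diffZ => //.
    exact: bounded_diff_truncated_overflow.
  apply: exp_increasing_le; rewrite Rplus_comm; apply: Rplus_le_compat.
    apply: Rmult_le_compat_l; first lra.
    rewrite big_enum rsum_const; apply: Rmult_le_compat_r; first nra.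
    exact: INR_leq.
  rewrite !(avgsZ m_gt0); apply: Rmult_le_compat_l => //.
  exact: avgs_truncated_overflow_le.
rewrite expectationZ.
have h_occ y : occ y / INR m <= h.
  by apply: Rmult_le_compat_r; [lra | apply: occ_le].
have c2 y : l * (occ y / INR m) <= / 2.
  by apply: Rle_trans lK; apply: Rmult_le_compat_l => //; have := h_occ y; lra.
have lW_diff y :
    bounded_diff (avgs (enum P) (fun H => l * W H)) y (l * (occ y / INR m)).
  by apply: bounded_diff_avgs => //; apply: bounded_diffZ.
have := expectation_exp_le m_gt0 c2 lW_diff.
rewrite (expectation_avgs m_gt0) expectationZ => E.
apply: Rle_trans (Rmult_le_compat_l _ _ _ _ E) _; first by left; apply: exp_pos.
rewrite -exp_plus; apply: exp_increasing_le.
(* Second round: the squared influences sum to at most [l ^ 2 * n * h ^ 2]. With [h <= K], the two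
   rounds together give the factor 4. *)
have -> : \rsum_(y : U) (l * (occ y / INR m)) ^ 2 =
          (l * / INR m) ^ 2 * \rsum_(y : U) occ y ^ 2.
  by rewrite big_distrr; apply: eq_bigr => y _ /=; field; lra.
have occ3 := sum_occ.
have occ_h : ((l * / INR m) ^ 2 * (\rsum_(y : U) occ y ^ 2) <= l ^ 2 * INR n * h ^ 2)%R.
  apply: Rle_trans (Rmult_le_compat_l _ _ _ _ occ3) _; first nra.
  by right; rewrite /h; field; lra.
have hK2 : (h ^ 2 <= K ^ 2)%R by nra.
have ln0 : (0 <= l ^ 2 * INR n)%R by apply: Rmult_le_pos => //; nra.
nra.
Qed.

End Overflow.

(** * Tail bound for the overflow *)

Lemma RltbP (x y : R) : reflect (x < y) (Rltb x y).
Proof. by rewrite /Rltb; case: Rlt_dec => ?; constructor. Qed.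

(** Either some bin receives more than [K] items of [P], or the truncation has no effect and the
    exponential moment applies. The two summands bound these two cases. *)
Lemma overflow_tail (U : finType) (m n cap : nat) (P : {set U})
    (S : U -> {set U}) (l K q T : R) :
  (0 < m)%nat -> (#|P| <= n)%nat ->
  (forall x, x \notin S x) -> (forall x, (#|S x| <= n)%nat) ->
  0 <= l -> l * K <= / 2 -> INR n / INR m <= K -> 0 <= q ->
  (forall x b, expectation (fun H : {ffun U -> 'I_m} =>
     INR (full cap S (bin H b) x)) <= q) ->
  expectation (fun H : {ffun U -> 'I_m} =>
     INR (Rltb T (INR (overflow cap P S H)))) <=
  INR m * exp (INR n / INR m - K / 2) +
  exp (l * (INR n * q) + 4 * l ^ 2 * INR n * K ^ 2 - l * T).
Proof.
move=> m_gt0 Pn S_irr Sn l0 lK hK q0 fq.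
set E1 := INR m * _; set E2 := exp _.
apply: (Rle_trans _ (expectation (fun H : {ffun U -> 'I_m} =>
   (\rsum_(b : 'I_m) exp (/ 2 * (INR #|P :&: bin H b| - K))) +
   exp (- (l * T)) * exp (l * truncated_overflow cap P S K H)))).
  apply: expectation_le => // H.
  set X := \big[_/_]_b _.
  have e0 z : 0 <= exp z by left; apply: exp_pos.
  have X0 : 0 <= X by apply: rsum_ge0.
  have Y0 := Rmult_le_pos _ _ (e0 (- (l * T))) (e0 (l * truncated_overflow cap P S K H)).
  case: RltbP => [TB|_] /=; last lra.
  have [/existsP[b /RltbP bK]|noK] :=
    boolP [exists b, Rltb K (INR #|P :&: bin H b|)].
    suff : 1 <= X by lra.
    rewrite /X (bigD1 b) //=; set Y := \big[_/_]_(i | _) _.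
    have : 0 <= Y by apply: rsum_ge0.
    by have := one_plus_le_exp (/ 2 * (INR #|P :&: bin H b| - K)); lra.
  have PK b : INR #|P :&: bin H b| <= K.
    apply: Rnot_lt_le => bK; case/negP: noK; apply/existsP; exists b.
    exact/RltbP.
  rewrite truncated_overflow_eq // -exp_plus.
  have := one_plus_le_exp (- (l * T) + l * INR (overflow cap P S H)).
  nra.
rewrite expectationD expectationZ; apply: Rplus_le_compat.
  rewrite expectation_sum.
  apply: Rle_trans (rsum_le_const (c := exp (INR n / INR m - K / 2)) _) _ => [b _|].
    (* For [l = 1/2] the factor [l + 2 * l ^ 2] equals 1. *)
    apply: Rle_trans (expectation_load_tail m_gt0 K b _ Pn) _; first lra.
    apply: exp_increasing_le; right; field.
    by apply: not_0_INR => m0; rewrite m0 in m_gt0.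
  by rewrite card_ord; apply: Rle_refl.
rewrite /E2 /Rminus Rplus_comm exp_plus; apply: Rmult_le_compat_l.
  by left; apply: exp_pos.
exact: truncated_overflow_mgf.
Qed.

(** * From the dynamics of the table to the static overflow count *)

Section Dynamics.
Variables (U : finType) (n : nat).

Lemma valid_from_cat (A : {set U}) (ops1 ops2 : seq (op U)) :
  valid_from n A (ops1 ++ ops2) =
  valid_from n A ops1 && valid_from n (foldl (@present_step U) A ops1) ops2.
Proof. by elim: ops1 A => //= o ops IH A; rewrite IH andbA. Qed.

Lemma valid_ops_take k (ops : seq (op U)) : valid_ops n ops -> valid_ops n (take k ops).
Proof. by rewrite -{1}(cat_take_drop k ops) /valid_ops valid_from_cat => /andP[]. Qed.

(* [S x] is the set of items present when [x] was last inserted. *)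
Lemma backyard_history (ops : seq (op U)) : valid_ops n ops ->
  exists S : U -> {set U},
  [/\ (#|present ops| <= n)%nat, forall x, x \notin S x,
      forall x, (#|S x| <= n)%nat &
      forall (m cap : nat) (H : {ffun U -> 'I_m}),
        (fb_run H cap ops).1 \subset present ops /\
        forall x, x \in (fb_run H cap ops).2 ->
          (x \in present ops) && full cap S (bin H (H x)) x].
Proof.
elim/last_ind: ops => [_|ops o IH].
  exists (fun=> set0); split => [|x|x|m cap H]; rewrite ?cards0 ?inE //.
  by split=> [|x]; rewrite ?sub0set // inE.
rewrite -cats1 /valid_ops valid_from_cat => /andP[/IH[S [Pn S_irr Sn hist]]] /=.
rewrite andbT -/(present ops) => vo.
have presE : present (ops ++ [:: o]) = present_step (present ops) o.
  by rewrite /present foldl_cat.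
have runE m cap (H : {ffun U -> 'I_m}) :
    fb_run H cap (ops ++ [:: o]) = fb_step H cap (fb_run H cap ops) o.
  by rewrite /fb_run foldl_cat.
case: o vo presE runE => x /= vo presE runE.
- case/andP: vo => xP xPn.
  (* An insertion replaces only the snapshot of the inserted item. *)
  exists (fun y => if y == x then present ops else S y).
  split=> [|y|y|m cap H]; first by rewrite presE.
  + by case: eqP => // ->.
  + by case: eqP.
  rewrite presE runE; have [] := hist m cap H.
  case: (fb_run H cap ops) => front back /= sub_front back_full.
  (* Older backyard items are present, hence differ from [x], and keep their snapshots. *)
  have old y : y \in back -> (y \in x |: present ops) &&
      full cap (fun y => if y == x then present ops else S y) (bin H (H y)) y.
    move=> /back_full /andP[yP fy]; rewrite !inE yP orbT /= /full.
    by case: eqP => // yx; rewrite yx (negbTE xP) in yP.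
  case: ltnP => cap_le /=; split=> //.
  + exact: setUS.
  + by apply: subset_trans sub_front _; apply: subsetUr.
  (* If [x] itself goes to the backyard, the front items filling its bin are among the present ones,
     so the bin is full for the new snapshot. *)
  move=> y; rewrite in_setU1 => /orP[/eqP->|/old //].
  rewrite setU11 /full eqxx; apply: leq_trans cap_le _.
  apply: subset_leq_card; apply/subsetP => z; rewrite !inE => /andP[zf ->].
  by rewrite (subsetP sub_front).
- exists S; split=> // [|m cap H]; rewrite presE.
    by apply: leq_trans Pn; apply: subset_leq_card; apply: subsetDl.
  rewrite runE; have [] := hist m cap H.
  case: (fb_run H cap ops) => front back /= sub_front back_full.
  split; first exact: setSD.
  by move=> y; rewrite !inE => /andP[-> /back_full].
Qed.

End Dynamics.

(** * Rounding of the capacity and choice of parameters *)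

(** The floor loses less than one, which the summand 1 in the capacity makes up for; nonnegativity
    keeps [Z.to_nat] from cutting off at 0. *)
Lemma bin_capacity_ge (h j : R) : 0 <= h -> 0 <= j ->
  h + j * sqrt h <= INR (bin_capacity h j).
Proof.
move=> h0 j0; rewrite /bin_capacity; set r := (h + _ + 1).
have s01 : sqrt h <= sqrt (h + 1) by apply: sqrt_le_1_alt; lra.
have s0 := sqrt_pos h.
have rE : h + j * sqrt h <= r - 1 by rewrite /r; nra.
have [_ r1] := base_Int_part r.
have r0 : 0 <= r - 1 by nra.
have z0 : (0 <= Int_part r)%Z by apply: Z.lt_le_incl; apply: lt_IZR; lra.
rewrite INR_IZR_INZ Znat.Z2Nat.id //; lra.
Qed.

Lemma ln_le_sub1 (x : R) : 0 < x -> ln x <= x - 1.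
Proof. by move=> x0; have := one_plus_le_exp (ln x); rewrite exp_ln //; lra. Qed.

Lemma hash_prob_expectation (U : finType) (m : nat)
    (E : {ffun U -> 'I_m} -> bool) :
  hash_prob E = expectation (fun H => INR (E H)).
Proof.
rewrite /hash_prob /expectation; congr (_ / _).
by rewrite -(INR_card predT).
Qed.

(* With [K := 2 h + 2 D ln n] and [l := sqrt (ln n) / (K sqrt n)] both terms of
   [overflow_tail] are of order [n ^ - D]. *)
Lemma tail_parameters (n m : nat) (j D : R) :
  let h := INR n / INR m in
  let T := (2 + 8 * D) * (D + 4) * (INR n / Rpower 2 (1 / 8 * j ^ 2)
             + Rpower (INR n) (3 / 4) * sqrt (ln (INR n))) in
  (256 <= n)%nat -> (0 < m)%nat -> (m <= n)%nat -> 1 <= D ->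
  h <= Rpower (INR n) (1 / 4) / sqrt (ln (INR n)) ->
  exists l K, [/\ 0 <= l, l * K <= / 2, h <= K,
    h - K / 2 = - (D * ln (INR n)) &
    l * (INR n * exp (- (j ^ 2 / 8))) + 4 * l ^ 2 * INR n * K ^ 2 - l * T <=
    - (D * ln (INR n))].
Proof.
move=> h T n256 m0 mn D1 h_le.
have n_ge : 256 <= INR n by have := INR_leq n256; rewrite INR_IZR_INZ.
have mR0 : 0 < INR m by apply: lt_0_INR; apply/ltP.
have h0 : 0 < h by apply: Rdiv_lt_0_compat; lra.
set L := ln (INR n) in T h_le *.
(* All powers of [n] are expressed through [a]; [n >= 256] gives [a >= 4]. *)
pose a := Rpower (INR n) (1 / 4).
have a0 : 0 < a by exact: exp_pos.
have a4 : a ^ 4 = INR n.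
  rewrite -Rpower_pow // Rpower_mult (_ : _ * _ = 1) ?Rpower_1 /=; lra.
have a3 : Rpower (INR n) (3 / 4) = a ^ 3.
  by rewrite -Rpower_pow // Rpower_mult; congr Rpower; rewrite /=; field.
have sn : sqrt (INR n) = a ^ 2.
  by rewrite -a4 (_ : a ^ 4 = a ^ 2 * a ^ 2) ?sqrt_square; [|nra|ring].
have a_ge4 : 4 <= a.
  by apply: Rnot_lt_le => a_lt; have : (a ^ 2 < 16)%R by [nra|]; nra.
have LE : L = 4 * ln a by rewrite /a /Rpower ln_exp /L; field.
have L_le : L <= 4 * a by have := ln_le_sub1 a0; lra.
have L_ge : 1 <= L.
  left; rewrite -(ln_exp 1); apply: ln_increasing; first exact: exp_pos.
  have := exp_le_3; lra.
pose r := sqrt L.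
have rr : r * r = L by apply: sqrt_sqrt; lra.
have r1 : 1 <= r by rewrite -sqrt_1; apply: sqrt_le_1_alt.
have ha : h <= a.
  apply: Rle_trans h_le _; rewrite -/a -/r.
  by apply: (Rmult_le_reg_r r); [lra | rewrite /Rdiv Rmult_assoc Rinv_l; nra].
pose K := 2 * h + 2 * D * L.
have DL0 : 0 < D * L by nra.
have K0 : 0 < K by rewrite /K; lra.
have K_le : K <= (2 + 8 * D) * a by rewrite /K; nra.
exists (r / (K * a ^ 2)), K; split.
- by left; apply: Rdiv_lt_0_compat; nra.
- rewrite (_ : _ * K = r / a ^ 2); last by field; lra.
  apply: (Rmult_le_reg_r (a ^ 2)); first nra.
  rewrite /Rdiv Rmult_assoc Rinv_l; last nra.
  (* [r <= a ^ 2 / 2] because [r ^ 2 = L <= 4 * a] and [a >= 4]. *)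
  apply: Rnot_lt_le => r_gt; nra.
- rewrite /K; lra.
- rewrite /K; field.
(* Passing from base e to base 2 uses [ln 2 <= 1]. *)
have q_le : INR n * exp (- (j ^ 2 / 8)) <= INR n / Rpower 2 (1 / 8 * j ^ 2).
  apply: Rmult_le_compat_l; first lra.
  rewrite /Rpower -exp_Ropp; apply: exp_increasing_le.
  have := ln_le_sub1 Rlt_0_2; nra.
have l0 : 0 < r / (K * a ^ 2) by apply: Rdiv_lt_0_compat; nra.
set l := r / _ in l0 *.
have quad : 4 * l ^ 2 * INR n * K ^ 2 = 4 * L.
  by rewrite -a4 -rr /l; field; lra.
rewrite quad /T a3 -/r; set Q := INR n / _ in q_le *.
have Q0 : 0 <= Q.
  apply: Rle_trans q_le; apply: Rmult_le_pos; first lra.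
  by left; apply: exp_pos.
(* The constant in [K <= B * a]. The [a ^ 3 * r] part of [l * T] pays for the quadratic term [4 * L]
   and the desired [D * L], the other part for the mean. *)
pose B := 2 + 8 * D.
have lin : (D + 4) * L <= l * (B * (D + 4) * (a ^ 3 * r)).
  rewrite (_ : l * _ = (D + 4) * L * (B * a / K)); last first.
    by rewrite -rr /l; field; lra.
  rewrite -[X in X <= _]Rmult_1_r; apply: Rmult_le_compat_l; first nra.
  apply: (Rmult_le_reg_r K) => //; rewrite /Rdiv Rmult_assoc Rinv_l; last lra.
  by rewrite Rmult_1_l Rmult_1_r.
have lq : l * (INR n * exp (- (j ^ 2 / 8))) <= l * (B * (D + 4) * Q).
  apply: Rmult_le_compat_l; first lra.
  apply: Rle_trans q_le _; rewrite -[X in X <= _]Rmult_1_l.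
  by apply: Rmult_le_compat_r => //; rewrite /B; nra.
rewrite -/B; lra.
Qed.

(** * Union bound over the moments *)

Lemma exists_le_sum (N : nat) (e : 'I_N -> bool) :
  INR [exists k, e k] <= \rsum_(k : 'I_N) INR (e k).
Proof.
rewrite -INR_sum; apply: INR_leq; case: existsP => //= -[k ek].
by rewrite (bigD1 k) //= ek.
Qed.

Close Scope R_scope.

Theorem theorem2p1 :
  forall (c : nat) (d : R), (0 < d)%R ->
  exists (C kappa : R) (N0 : nat), (0 < C)%R /\ (0 < kappa)%R /\
  forall (n m : nat) (j : R) (U : finType) (ops : seq (op U)),
    (N0 <= n)%N -> (0 < m)%N ->
    let h := (INR n / INR m)%R in
    (h <= Rpower (INR n) (1/4) / sqrt (ln (INR n)))%R ->
    (0 < j)%R -> (j <= sqrt h)%R ->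
    (size ops <= m ^ c)%N ->
    valid_ops n ops ->
    (hash_prob (fun H : {ffun U -> 'I_m} =>
       [exists k : 'I_(size ops).+1,
          Rltb
            (C * (INR n / Rpower 2 (kappa * j ^ 2)
                  + Rpower (INR n) (3/4) * sqrt (ln (INR n))))%R
            (INR (backyard_size H (bin_capacity h j) ops k))])
     <= Rpower (INR n) (- d))%R.
Proof.
(* Of the exponent, [c] pays for the number of moments, 2 for the factor [n + 1] of each moment and
   the constants, and [d] remains. *)
move=> c d d0; pose D := (INR c + 2 + d)%R.
have D1 : (1 <= D)%R by rewrite /D; have := pos_INR c; lra.
(* [C] is the factor of [T] in [tail_parameters], [1 / 8] comes from the Chernoff exponent, and 256
   makes the fourth root of [n] at least 4. *)
exists ((2 + 8 * D) * (D + 4))%R, (1 / 8)%R, 256.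
split; first nra; split; first lra.
move=> n m j U ops n256 m0 h h_le j0 jh sz vops.
set T := (_ * (_ + _))%R.
have n_ge : (256 <= INR n)%R by have := INR_leq n256; rewrite INR_IZR_INZ.
have mR0 : (0 < INR m)%R by apply: lt_0_INR; apply/ltP.
rewrite hash_prob_expectation.
(* If [m > n], then [h] and [j] are at most 1, so the first term of the bound is at least [n / 2];
   as [C >= 2], the threshold is at least [n] and the event is empty. *)
have [mn|nm] := leqP m n; last first.
  have h1 : (h <= 1)%R.
    apply: (Rmult_le_reg_r (INR m)) => //; rewrite /h /Rdiv Rmult_assoc Rinv_l; last lra.
    by have := INR_leq (ltnW nm); lra.
  have j1 : (j <= 1)%R.
    by apply: Rle_trans jh _; rewrite -sqrt_1; apply: sqrt_le_1_alt.
  rewrite (eq_expectation (g := fun=> 0%R)) ?expectation_cst //.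
    by left; apply: exp_pos.
  move=> H; case: existsP => //= -[k /RltbP]; rewrite /backyard_size => TB.
  have [S [Pn _ _ hist]] := backyard_history (valid_ops_take k vops).
  have [_ back_full] := hist m (bin_capacity h j) H.
  have Bn : (INR #|(fb_run H (bin_capacity h j) (take k ops)).2| <= INR n)%R.
    apply: INR_leq; apply: leq_trans Pn; apply: subset_leq_card.
    by apply/subsetP => x /back_full /andP[].
  have p2 : (Rpower 2 (1 / 8 * j ^ 2) <= 2)%R.
    rewrite -[X in (_ <= X)%R]Rpower_1; last lra.
    apply: Rle_Rpower; nra.
  have p0 : (0 < Rpower 2 (1 / 8 * j ^ 2))%R by exact: exp_pos.
  have Q2 : (INR n / 2 <= INR n / Rpower 2 (1 / 8 * j ^ 2))%R.
    by apply: Rmult_le_compat_l; [lra | apply: Rinv_le_contravar].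
  have R0 : (0 <= Rpower (INR n) (3 / 4) * sqrt (ln (INR n)))%R.
    by apply: Rmult_le_pos; [left; exact: exp_pos | exact: sqrt_pos].
  have C2 : (2 <= (2 + 8 * D) * (D + 4))%R by nra.
  suff : (INR n <= T)%R by lra.
  rewrite /T; nra.
have [l [K [l0 lK hK hKE exponent]]] := tail_parameters j n256 m0 mn D1 h_le.
rewrite -/T in exponent.
pose E := exp (- (D * ln (INR n))).
have step (k : 'I_(size ops).+1) :
    (expectation (fun H : {ffun U -> 'I_m} =>
       INR (Rltb T (INR (backyard_size H (bin_capacity h j) ops k))))
     <= (INR n + 1) * E)%R.
  have [S [Pn S_irr Sn hist]] := backyard_history (valid_ops_take k vops).
  set P := present _ in Pn hist.
  (* The backyard at moment [k] is contained in the set counted by [overflow]. *)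
  apply: (Rle_trans _ (expectation (fun H : {ffun U -> 'I_m} =>
     INR (Rltb T (INR (overflow (bin_capacity h j) P S H)))))).
    apply: expectation_le => // H; case: RltbP => [TB|_]; last exact: pos_INR.
    case: RltbP => [_|nTB]; first exact: Rle_refl.
    case: nTB; apply: Rlt_le_trans TB _; apply: INR_leq.
    apply: subset_leq_card; apply/subsetP => x.
    by have [_ back_full] := hist m (bin_capacity h j) H; rewrite inE => /back_full.
  have h0 : (0 <= h)%R by apply: Rmult_le_pos; [lra | left; apply: Rinv_0_lt_compat].
  have q_full x b : (expectation (fun H : {ffun U -> 'I_m} =>
      INR (full (bin_capacity h j) S (bin H b) x)) <= exp (- (j ^ 2 / 8)))%R.
    apply: (chernoff_full_bin m0 (n := n)) => //.
    by apply: bin_capacity_ge => //; lra.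
  have q0 : (0 <= exp (- (j ^ 2 / 8)))%R by left; apply: exp_pos.
  apply: Rle_trans (overflow_tail T m0 Pn S_irr Sn l0 lK hK q0 q_full) _.
  rewrite -/h hKE -/E Rmult_plus_distr_r Rmult_1_l; apply: Rplus_le_compat.
    by apply: Rmult_le_compat_r; [left; apply: exp_pos | apply: INR_leq].
  exact: exp_increasing_le.
apply: (Rle_trans _ (\rsum_(k : 'I_(size ops).+1) (INR n + 1) * E)%R).
  apply: (Rle_trans _ (expectation (fun H : {ffun U -> 'I_m} =>
    \rsum_(k : 'I_(size ops).+1)
       INR (Rltb T (INR (backyard_size H (bin_capacity h j) ops k))))%R)).
    by apply: expectation_le => // H; apply: exists_le_sum.
  by rewrite expectation_sum; apply: rsum_le => k _; apply: step.
rewrite rsum_const card_ord S_INR.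
have szR : (INR (size ops) <= INR n ^ c)%R.
  apply: Rle_trans (INR_leq sz) _; rewrite pow_INR.
  by apply: pow_incr; split; [exact: pos_INR | exact: INR_leq].
have nc1 : (1 <= INR n ^ c)%R by apply: pow_R1_Rle; lra.
have E0 : (0 < E)%R by exact: exp_pos.
have -> : Rpower (INR n) (- d) = (INR n ^ c * INR n ^ 2 * E)%R.
  rewrite -!Rpower_pow; try lra.
  by rewrite /Rpower /E -!exp_plus; congr exp; rewrite /D /=; ring.
rewrite -Rmult_assoc; apply: Rmult_le_compat_r; first lra.
(* The resulting constant 4 is absorbed by the second factor [n]. *)
apply: (Rle_trans _ ((2 * INR n ^ c) * (2 * INR n))%R).
  by have s0 := pos_INR (size ops); apply: Rmult_le_compat; lra.
have pn0 : (0 <= INR n ^ c * INR n)%R by apply: Rmult_le_pos; lra.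
nra.
Qed.
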